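(* Let $L:G\to\mathbb R$ be a regular discrete Lagrangian on a Lie groupoid $G\rightrightarrows M$, with discrete Euler–Lagrange evolution operator $\xi_L:G\to G$. If $X\in\Gamma(\tau)$ is a Noether symmetry of $L$, with $f\in C^\infty(M)$ such that $dL(X^{(1,1)})=\beta^*f-\alpha^*f$, then the function $F=\Theta_L^-(X^{(1,1)})-\alpha^*f$ is a constant of the motion for the discrete dynamics defined by $L$, that is, $F\circ\xi_L=F$.
   Context: A Lie groupoid $G\rightrightarrows M$ has source $\alpha$ and target $\beta$ (surjective submersions $G\to M$), identity section $\epsilon:M\to G$, inversion $i(g)=g^{-1}$, and a product $gh$ defined for $(g,h)\in G_2=\{(g,h):\beta(g)=\alpha(h)\}$, with $\alpha(gh)=\alpha(g)$, $\beta(gh)=\beta(h)$. Translations: $l_g:\alpha^{-1}(\beta(g))\to\alpha^{-1}(\alpha(g))$, $h\mapsto gh$, and $r_g:\beta^{-1}(\alpha(g))\to\beta^{-1}(\beta(g))$, $h\mapsto hg$. Put $V\alpha=\ker T\alpha$, $V\beta=\ker T\beta$. The Lie algebroid $\tau:AG\to M$ of $G$ has fibre $A_xG=V_{\epsilon(x)}\alpha$. For $X\in\Gamma(\tau)$ define vector fields on $G$ by $\overleftarrow X(g)=(T_{\epsilon(\beta(g))}l_g)(X(\beta(g)))$ (a section of $V\alpha$) and $\overrightarrow X(g)=-(T_{\epsilon(\alpha(g))}(r_g\circ i))(X(\alpha(g)))$ (a section of $V\beta$). The bracket and anchor of $AG$ are given by $\overleftarrow{[\![X,Y]\!]}=[\overleftarrow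 X,\overleftarrow Y]$ and $\rho(X)(x)=(T_{\epsilon(x)}\beta)(X(x))$. The vector bundle $\mathcal P^\tau G\equiv V\beta\oplus_G V\alpha\to G$ carries the Lie algebroid structure with anchor $(X_g,Y_g)\mapsto X_g+Y_g$ and bracket characterized by $[\![(\overrightarrow X,\overleftarrow Y),(\overrightarrow{X'},\overleftarrow{Y'})]\!]=(-\overrightarrow{[\![X,X']\!]},\overleftarrow{[\![Y,Y']\!]})$. $d$ is the differential of this Lie algebroid: $dF(Z)=\rho(Z)F$ for functions, $d\mu(Z,W)=\rho(Z)(\mu(W))-\rho(W)(\mu(Z))-\mu([\![Z,W]\!])$ for sections $\mu$ of the dual. The complete lift of $X\in\Gamma(\tau)$ is the section $X^{(1,1)}(g)=(-\overrightarrow X(g),\overleftarrow X(g))$ of $\mathcal P^\tau G$, so $dL(X^{(1,1)})=-\overrightarrow XL+\overleftarrow XL$. A discrete Lagrangian is a smooth function $L:G\to\mathbb R$. Put $\Theta_L^-(g)(X_g,Y_g)=-X_g(L)$ for $(X_g,Y_g)\in V_g\beta\oplus V_g\alpha$ and $\Omega_L=-d\Theta_L^-$; $L$ is regular if $\Omega_L$ is nondegenerate on every fibre. A section $X$ of $AG$ is a Noether symmetry of $L$ if there is $f\in C^\infty(M)$ with $dL(X^{(1,1)})=\beta^*f-\alpha^*f$, where $\alpha^*f=f\circ\alpha$, $\beta^*f=f\circ\beta$. A discrete Euler–Lagrange (Lagrangian) evolution operator for $L$ is a smooth map $\xi_L:G\to G$ such that for all $g\in G$, $(g,\xi_L(g))\in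 G_2$ and $\overleftarrow X(g)(L)-\overrightarrow X(\xi_L(g))(L)=0$ for all $X\in\Gamma(\tau)$. A constant of the motion is a function $F$ on $G$ with $F\circ\xi_L=F$. *)

(* Defs.v *)
From HB Require Import structures.
From mathcomp Require Import all_boot all_order all_algebra.
From mathcomp Require Import all_classical all_reals topology normedtype derive.

Set Implicit Arguments.
Unset Strict Implicit.
Unset Printing Implicit Defensive.

Import Order.TTheory GRing.Theory Num.Theory.
Import numFieldNormedType.Exports.

Local Open Scope classical_set_scope.
Local Open Scope ring_scope.

Fixpoint Ck_on (R : realType) (n k : nat) (U : set 'rV[R]_n)
    (f : 'rV[R]_n -> R) : Prop :=
  (forall x, U x -> {for x, continuous f}) /\
  if k is k'.+1 then
    forall i : 'I_n,
      (forall x, U x -> derivable f x (delta_mx 0 i)) /\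
      Ck_on k' U (fun x => 'D_(delta_mx 0 i) f x)
  else True.

Definition smooth_on (R : realType) (n : nat) (U : set 'rV[R]_n)
    (f : 'rV[R]_n -> R) : Prop := forall k, Ck_on k U f.

(* The values of [fwd] off [dom] and of [bwd] off [fwd @` dom] are junk. *)
Record chart (R : realType) (T : topologicalType) (n : nat) := Chart {
  dom : set T;
  fwd : T -> 'rV[R]_n;
  bwd : 'rV[R]_n -> T;
  dom_open : open dom;
  img_open : open (fwd @` dom);
  fwdK : forall p, dom p -> bwd (fwd p) = p;
  fwd_cont : forall p, dom p -> {for p, continuous fwd};
  bwd_cont : forall x, (fwd @` dom) x -> {for x, continuous bwd} }.

Definition img (R : realType) (T : topologicalType) (n : nat)
  (c : chart R T n) : set 'rV[R]_n := fwd c @` dom c.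

Record manifold (R : realType) := Manifold {
  carrier :> topologicalType;
  dim : nat;
  atlas : set (chart R carrier dim);
  manifold_hausdorff : hausdorff_space carrier;
  manifold_second_countable : @second_countable carrier;
  atlas_cover : forall p, exists2 c, atlas c & dom c p;
  atlas_compat : forall c d, atlas c -> atlas d -> forall i : 'I_dim,
    smooth_on (img c `&` bwd c @^-1` dom d) (fun x => fwd d (bwd c x) 0 i) }.

Section Smooth.
Variable R : realType.

Definition smooth_map (M N : manifold R) (phi : M -> N) : Prop :=
  continuous phi /\
  forall c d, @atlas R M c -> @atlas R N d -> forall i : 'I_(dim N),
    smooth_on (img c `&` [set x | dom d (phi (bwd c x))])
      (fun x => fwd d (phi (bwd c x)) 0 i).

Definition smooth_fun (M : manifold R) : set (M -> R) :=
  [set f : M -> R | forall c, @atlas R M c -> smooth_on (img c) (f \o bwd c)].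

(* C^oo(M x N), read in the product charts. *)
Definition smooth_fun_prod (M N : manifold R) : set (M * N -> R) :=
  [set f : M * N -> R | forall c d, @atlas R M c -> @atlas R N d ->
    smooth_on [set z : 'rV[R]_(dim M + dim N) |
                 img c (lsubmx z) /\ img d (rsubmx z)]
      (fun z => f (bwd c (lsubmx z), bwd d (rsubmx z)))].

(* Smooth functions on a subset S of a space with algebra of smooth functions
   A: the local restrictions of elements of A.  When S is an embedded
   submanifold (as are the alpha- and beta-fibres and the set of composable
   pairs) these are the smooth functions of that submanifold. *)
Definition smooth_fun_sub (T : topologicalType) (A : set (T -> R))
    (S : T -> Prop) : set ({x : T | S x} -> R) :=
  [set f : {x : T | S x} -> R | forall p : {x : T | S x}, exists U : set T, exists F : T -> R,
    [/\ open U, U (sval p), A F &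
        forall q : {x : T | S x}, U (sval q) -> f q = F (sval q)]].

(* Tangent vectors are derivations of the algebra A of smooth functions.  They
   are applied to arbitrary functions, and are required to vanish on non-smooth
   ones, so that equal derivations are equal as Rocq functions. *)
Definition tvec (T : Type) : Type := (T -> R) -> R.

Definition tangent (T : Type) (A : set (T -> R)) (p : T) : set (tvec T) :=
  [set v : tvec T |
    [/\ forall (a : R) f g, A f -> A g ->
          v (fun x => a * f x + g x) = a * v f + v g,
        forall f g, A f -> A g ->
          v (fun x => f x * g x) = f p * v g + g p * v f &
        forall f, ~ A f -> v f = 0]].

Definition tmap (T T' : Type) (A' : set (T' -> R)) (phi : T -> T')
    (v : tvec T) : tvec T' :=
  fun f => if `[< A' f >] then v (f \o phi) else 0.

(* T_p of a submanifold S is identified with a subspace of T_p of the ambient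
   space by the tangent map of the inclusion, which is injective; this is the
   inverse of that identification. *)
Definition tangent_sub (T : topologicalType) (A : set (T -> R))
    (S : T -> Prop) (p : {x : T | S x}) (v : tvec T) : tvec {x : T | S x} :=
  xget (fun=> 0 : R)
    [set u | tangent (smooth_fun_sub A (S := S)) p u /\ tmap A sval u = v].

Definition submersion (M N : manifold R) (phi : M -> N) : Prop :=
  smooth_map phi /\
  forall p w, tangent (smooth_fun (M := N)) (phi p) w ->
    exists2 v, tangent (smooth_fun (M := M)) p v
             & tmap (smooth_fun (M := N)) phi v = w.

Definition vertical (M N : manifold R) (phi : M -> N) (p : M) : set (tvec M) :=
  [set v | tangent (smooth_fun (M := M)) p v /\
           tmap (smooth_fun (M := N)) phi v = fun=> 0].

Definition vfield_bracket (T : Type) (V W : T -> tvec T) : T -> tvec T :=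
  fun p f => V p (fun q => W q f) - W p (fun q => V q f).

End Smooth.

Arguments smooth_fun {R} M.
Arguments smooth_fun_prod {R} M N.
Arguments smooth_fun_sub {R T} A S.

(* The composite g h is defined when beta g = alpha h, and the product is a
   smooth map on the submanifold of composable pairs of arrows x arrows. *)
Record lieGroupoid (R : realType) := LieGroupoid {
  arrows :> manifold R;
  base : manifold R;
  alpha : arrows -> base;
  beta : arrows -> base;
  eps : base -> arrows;
  inv : arrows -> arrows;
  mul : forall g h, beta g = alpha h -> arrows;
  alpha_subm : submersion alpha;
  alpha_surj : forall x, exists g, alpha g = x;
  beta_subm : submersion beta;
  beta_surj : forall x, exists g, beta g = x;
  eps_smooth : smooth_map eps;
  inv_smooth : smooth_map inv;
  mul_smooth : forall F, smooth_fun arrows F ->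
    smooth_fun_sub (smooth_fun_prod arrows arrows)
      (fun p => beta p.1 = alpha p.2)
      (fun p => F (mul (svalP p)));
  alpha_mul : forall g h (e : beta g = alpha h), alpha (mul e) = alpha g;
  beta_mul : forall g h (e : beta g = alpha h), beta (mul e) = beta h;
  mulA : forall g h k (e1 : beta g = alpha h) (e2 : beta h = alpha k)
    (e3 : beta (mul e1) = alpha k) (e4 : beta g = alpha (mul e2)),
    mul e3 = mul e4;
  alpha_eps : forall x, alpha (eps x) = x;
  beta_eps : forall x, beta (eps x) = x;
  mul_epsl : forall g (e : beta (eps (alpha g)) = alpha g), mul e = g;
  mul_epsr : forall g (e : beta g = alpha (eps (beta g))), mul e = g;
  alpha_inv : forall g, alpha (inv g) = beta g;
  beta_inv : forall g, beta (inv g) = alpha g;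
  mulV : forall g (e : beta g = alpha (inv g)), mul e = eps (alpha g);
  mulVl : forall g (e : beta (inv g) = alpha g), mul e = eps (beta g) }.

Arguments alpha {R} G g : rename.
Arguments beta {R} G g : rename.
Arguments eps {R} G x : rename.
Arguments inv {R} G g : rename.

Section Groupoid.
Variables (R : realType) (G : lieGroupoid R).
Local Notation M := (base G).

Definition alpha_fib (x : M) : Type := {h : G | alpha G h = x}.
Definition beta_fib (x : M) : Type := {h : G | beta G h = x}.

Definition alpha_fib_smooth (x : M) : set (alpha_fib x -> R) :=
  smooth_fun_sub (smooth_fun G) (fun h => alpha G h = x).
Definition beta_fib_smooth (x : M) : set (beta_fib x -> R) :=
  smooth_fun_sub (smooth_fun G) (fun h => beta G h = x).

Definition ltrans (g : G) (h : alpha_fib (beta G g)) : alpha_fib (alpha G g) :=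
  exist _ (mul (esym (svalP h))) (alpha_mul (esym (svalP h))).

Definition rtrans (g : G) (h : beta_fib (alpha G g)) : beta_fib (beta G g) :=
  exist _ (mul (svalP h)) (beta_mul (svalP h)).

Definition inv_fib (x : M) (h : alpha_fib x) : beta_fib x :=
  exist _ (inv G (sval h)) (etrans (beta_inv (sval h)) (svalP h)).

Definition eps_fib (x : M) : alpha_fib x := exist _ (eps G x) (alpha_eps x).

Definition AG_fibre (x : M) : set (tvec R G) := vertical (alpha G) (eps G x).

(* AG is a subbundle of the pull-back of TG along eps, so X is smooth when its
   derivatives x |-> X x f of the smooth functions f on G are smooth. *)
Definition AG_section (X : M -> tvec R G) : Prop :=
  (forall x, AG_fibre x (X x)) /\
  forall f, smooth_fun G f -> smooth_fun M (fun x => X x f).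

(* [tmap ltrans] yields a vector tangent to an alpha-fibre; the outer
   [tmap sval] sees it as a vector tangent to G.  Likewise for [right_vf],
   with beta-fibres. *)
Definition left_vf (X : M -> tvec R G) : G -> tvec R G := fun g =>
  tmap (smooth_fun G) sval
    (tmap (@alpha_fib_smooth (alpha G g)) (@ltrans g)
      (tangent_sub (smooth_fun G) (eps_fib (beta G g)) (X (beta G g)))).

Definition right_vf (X : M -> tvec R G) : G -> tvec R G := fun g =>
  - tmap (smooth_fun G) sval
      (tmap (@beta_fib_smooth (beta G g)) (@rtrans g \o @inv_fib (alpha G g))
        (tangent_sub (smooth_fun G) (eps_fib (alpha G g)) (X (alpha G g)))).

(* The unique section Z with left_vf Z = [left_vf X, left_vf Y]. *)
Definition AG_bracket (X Y : M -> tvec R G) : M -> tvec R G :=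
  xget (fun _ _ => 0 : R)
    [set Z | AG_section Z /\
             left_vf Z = vfield_bracket (left_vf X) (left_vf Y)].

Definition P_fibre (g : G) : set (tvec R G * tvec R G) :=
  [set z | vertical (beta G) g z.1 /\ vertical (alpha G) g z.2].

Definition P_section (Z : G -> tvec R G * tvec R G) : Prop :=
  (forall g, P_fibre g (Z g)) /\
  forall f, smooth_fun G f ->
    smooth_fun G (fun g => (Z g).1 f) /\ smooth_fun G (fun g => (Z g).2 f).

Definition P_anchor (Z : G -> tvec R G * tvec R G) : G -> tvec R G :=
  fun g => (Z g).1 + (Z g).2.

Definition P_scale (F : G -> R) (Z : G -> tvec R G * tvec R G) :
    G -> tvec R G * tvec R G :=
  fun g => (F g \*o (Z g).1, F g \*o (Z g).2).

Definition P_invariant (X Y : M -> tvec R G) : G -> tvec R G * tvec R G :=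
  fun g => (right_vf X g, left_vf Y g).

(* Lie algebroid brackets on P^tau G for the anchor [P_anchor] with the
   prescribed values on the sections (right_vf X, left_vf Y).  Such sections
   generate all sections locally, so there is only one such bracket. *)
Definition is_P_bracket
    (br : (G -> tvec R G * tvec R G) -> (G -> tvec R G * tvec R G) ->
          G -> tvec R G * tvec R G) : Prop :=
  [/\ forall Z W, P_section Z -> P_section W -> P_section (br Z W),
      forall Z W, P_section Z -> P_section W -> br Z W = - br W Z,
      forall Z W W', P_section Z -> P_section W -> P_section W' ->
        br Z (W + W') = br Z W + br Z W' /\
        br Z (br W W') + br W (br W' Z) + br W' (br Z W) = 0,
      forall F Z W, smooth_fun G F -> P_section Z -> P_section W ->
        br Z (P_scale F W) =
        P_scale F (br Z W) + P_scale (fun g => P_anchor Z g F) W &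
      forall X Y X' Y', AG_section X -> AG_section Y ->
        AG_section X' -> AG_section Y' ->
        br (P_invariant X Y) (P_invariant X' Y') =
        (fun g => (- right_vf (AG_bracket X X') g,
                   left_vf (AG_bracket Y Y') g))].

Definition P_bracket := xget (fun _ _ _ => (fun=> 0, fun=> 0)) is_P_bracket.

Definition P_d0 (F : G -> R) (Z : G -> tvec R G * tvec R G) : G -> R :=
  fun g => P_anchor Z g F.

Definition P_d1 (mu : G -> tvec R G * tvec R G -> R)
    (Z W : G -> tvec R G * tvec R G) : G -> R :=
  fun g => P_anchor Z g (fun h => mu h (W h))
         - P_anchor W g (fun h => mu h (Z h))
         - mu g (P_bracket Z W g).

(* The value at g of the 2-form [P_d1 mu]: by tensoriality it does not depend
   on the sections through z and w. *)
Definition P_d1_at (mu : G -> tvec R G * tvec R G -> R) (g : G)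
    (z w : tvec R G * tvec R G) : R :=
  xget 0 [set r | exists Z, exists W,
    [/\ P_section Z, P_section W, Z g = z, W g = w & r = P_d1 mu Z W g]].

Definition complete_lift (X : M -> tvec R G) : G -> tvec R G * tvec R G :=
  fun g => (- right_vf X g, left_vf X g).

Definition Theta_minus (L : G -> R) (g : G) (z : tvec R G * tvec R G) : R :=
  - z.1 L.

Definition Omega (L : G -> R) (g : G) (z w : tvec R G * tvec R G) : R :=
  - P_d1_at (Theta_minus L) g z w.

Definition regular (L : G -> R) : Prop :=
  forall g z, P_fibre g z ->
    (forall w, P_fibre g w -> Omega L g z w = 0) -> z = (fun=> 0, fun=> 0).

Definition noether_symmetry_with (L : G -> R) (X : M -> tvec R G)
    (f : M -> R) : Prop :=
  [/\ AG_section X, smooth_fun M f &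
      P_d0 L (complete_lift X) = fun g => f (beta G g) - f (alpha G g)].

Definition evolution_operator (L : G -> R) (xi : G -> G) : Prop :=
  smooth_map xi /\
  forall g, beta G g = alpha G (xi g) /\
    forall X, AG_section X -> left_vf X g L - right_vf X (xi g) L = 0.

Definition constant_of_motion (xi : G -> G) (F : G -> R) : Prop := F \o xi = F.

End Groupoid.

(* Main.v *)
Require Import Defs.
From mathcomp Require Import all_boot all_order all_algebra.
From mathcomp Require Import all_classical all_reals topology normedtype derive.
From mathcomp Require Import ring.

Import GRing.Theory.
Local Open Scope ring_scope.

(** The two signs in [Theta_minus] and [complete_lift] cancel, so the function
    in question is [right_vf X g L - f (alpha G g)].  The Noether condition
    says that it can equally be computed at the other end of the arrow [g], as
    [left_vf X g L - f (beta G g)] ([noether_two_ends]).  The dynamics matches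
    this target-end expression at [g] with the source-end expression at [xi g]:
    the discrete Euler-Lagrange equation, tested on the symmetry [X] itself,
    identifies the momenta, and composability, [beta G g = alpha G (xi g)],
    identifies the values of [f]. *)

(** Along the complete lift, [dL] is the momentum at the target of [g] minus the
    momentum at its source, so a coboundary value [f (beta G g) - f (alpha G g)]
    can be split between the two ends. *)
Lemma noether_two_ends (R : realType) (G : lieGroupoid R) (L : G -> R)
    (X : base G -> tvec R G) (f : base G -> R) (g : G) :
  noether_symmetry_with L X f ->
  right_vf X g L - f (alpha G g) = left_vf X g L - f (beta G g).
Proof.
case=> _ _ /(congr1 (fun F => F g)) dL_lift.
have dLX : - right_vf X g L + left_vf X g L = f (beta G g) - f (alpha G g).
  exact: dL_lift.
by apply: subr0_eq; rewrite -[f (alpha G g)](subKr (f (beta G g))) -dLX; ring.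
Qed.

Theorem theorem4p19 (R : realType) (G : lieGroupoid R) (L : G -> R)
  (xi : G -> G) (X : base G -> tvec R G) (f : base G -> R) :
  smooth_fun G L -> regular L -> evolution_operator L xi ->
  noether_symmetry_with L X f ->
  constant_of_motion xi
    (fun g => Theta_minus L g (complete_lift X g) - f (alpha G g)).
Proof.
move=> _ _ [_ xiEL] symX; have [secX _ _] := symX.
have momentumE g : Theta_minus L g (complete_lift X g) = right_vf X g L.
  exact: opprK.
apply/funext => g /=; rewrite !momentumE (noether_two_ends _ _ _ _ _ g symX).
have [<- /(_ X secX) EL] := xiEL g.
by rewrite (subr0_eq EL).
Qed.
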